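(* Let $p$ be an odd prime, let $\ell$ and $d$ be positive integers, and let $q = p^{\ell}$. Let $A \subset \mathbb{Z}_q$ satisfy $$|A| > q^{\frac{2\ell-1}{2\ell} + \frac{1}{2\ell d}}.$$ Then $$\mathbb{Z}_q^{\times} \subset dA^2 = A\cdot A + \dots + A\cdot A .$$
   Context: $\mathbb{Z}_q = \mathbb{Z}/q\mathbb{Z}$ is the ring of integers modulo $q$ and $\mathbb{Z}_q^{\times}$ is its group of units. For $A \subset \mathbb{Z}_q$, $A\cdot A = A^2 = \{a\cdot a' : a,a'\in A\}$, and $dA^2 = A^2 + \dots + A^2$ ($d$ summands) is the $d$-fold sumset, i.e. the set of all $a_1a_1' + \dots + a_da_d'$ with $a_i,a_i'\in A$. *)

(* Defs.v *)
(* Library world: MathComp + MathComp-Analysis. *)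
From mathcomp Require Import all_boot all_order all_algebra.
From mathcomp Require Import all_classical all_reals all_analysis.

Set Implicit Arguments.
Unset Strict Implicit.
Unset Printing Implicit Defensive.

Import GRing.Theory.
Local Open Scope ring_scope.

(* Set operations below are those of finset, not of classical_sets. *)

Definition prodset (T : finNzRingType) (A B : {set T}) : {set T} :=
  [set a * b | a in A, b in B].

(* B + ... + B with d summands; for d = 0 this is {0}. *)
Definition dfold_sumset (T : finNzRingType) (d : nat) (B : {set T}) : {set T} :=
  [set \sum_(i < d) f i | f : {ffun 'I_d -> T} in ffun_on (mem B)].

Definition unit_set (T : finUnitRingType) : {set T} :=
  [set x : T | x \is a GRing.unit].

(* Main.v *)
Require Import Defs.
From mathcomp Require Import all_boot all_order all_algebra.
From mathcomp Require Import all_classical all_reals all_analysis.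
From mathcomp Require Import zify ring.

Set Implicit Arguments.
Unset Strict Implicit.
Unset Printing Implicit Defensive.

Import mathcomp.boot.fintype mathcomp.boot.finset Order.TTheory GRing.Theory Num.Theory.
Local Open Scope ring_scope.

(** Write q = p^l, R = Z/qZ, and let E be the set of vectors of R^d all of
    whose coordinates lie in A.  A unit t lies in dA^2 exactly when t = x.y for
    some x, y in E, so suppose that no two vectors of E have dot product t.

    The proof is a second moment argument.  Let E' be the set of primitive
    vectors of E (some coordinate is a unit), let e = |E'|, and let N(x) be the
    number of y in E' with x.y = t.
    - For primitive y the equation x.y = t has q^(d-1) solutions, so the sum of N is at least
      e q^(d-1) ([incidence_first_moment]).
    - The sum of N^2 counts triples (x, y, z) with x.y = t and x.(z - y) = 0.
      If the system x.y = t, x.w = 0 is solvable then, t being a unit, the map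
      x |-> (x.y, x.w) is onto R x J, where J is the ideal of the coordinates
      of w; divisibility in R being a total preorder, J is principal, so that
      |J| = q / |Ann w|, and the system has at most q^(d-2) |Ann w| solutions
      ([card_affine_section]).  Writing |Ann w| as a sum over the scalars s
      that kill w bounds the sum of N^2 by q^(d-2) e (e + W), where W is the
      number of pairs (s, w) with s nonzero and s w = 0
      ([incidence_second_moment]).
    - N vanishes on E' by assumption, and on nonprimitive vectors because t is
      a unit.  If T is the number of nonprimitive vectors, the Cauchy-Schwarz
      inequality on the support of N therefore gives
      (e + T) (e + W) <= q^d W.
      All nonprimitive vectors are killed by one nonzero scalar, so T <= W,
      while |E| <= e + T; hence |E|^2 <= q^d W ([dot_product_free_bound]).

    Discarding the nonprimitive vectors from E would lose too much for the
    sharp constant 1; it is harmless here because they return as zeros of N.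

    Finally W is the sum of gcd(s, q)^d over nonzero s, which is at most
    q^d / p^(d-1) for d >= 2 by induction on l ([annihilator_weight_Zp]).  So
    |A|^(2d) p^(d-1) <= q^(2d), which trivially holds for d = 1 too, and this
    is the negation of the hypothesis on |A| ([powR_threshold]). *)

(** * Dot products and finite chain rings *)

Definition ring_divides (R : nzRingType) (a b : R) : Prop := exists r, b = r * a.

Definition chain_ring (R : nzRingType) : Prop :=
  forall a b : R, ring_divides a b \/ ring_divides b a.

Definition dot (R : nzRingType) d (x y : 'rV[R]_d) : R :=
  \sum_(i < d) x 0 i * y 0 i.

Section Dot.
Variables (R : comNzRingType) (d : nat).
Implicit Types x y z : 'rV[R]_d.
Lemma dotDl x y z : dot (x + y) z = dot x z + dot y z.
Proof. by rewrite -big_split; apply: eq_bigr => i _; rewrite mxE mulrDl. Qed.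

Lemma dotZl a x y : dot (a *: x) y = a * dot x y.
Proof. by rewrite mulr_sumr; apply: eq_bigr => i _; rewrite mxE mulrA. Qed.

Lemma dotC x y : dot x y = dot y x.
Proof. by apply: eq_bigr => i _; rewrite mulrC. Qed.

Lemma dotNl x y : dot (- x) y = - dot x y.
Proof. by rewrite -scaleN1r dotZl mulN1r. Qed.

Lemma dotBr x y z : dot x (y - z) = dot x y - dot x z.
Proof. by rewrite dotC dotDl dotNl !(dotC x). Qed.

Lemma dot_delta i y : dot (delta_mx 0 i) y = y 0 i.
Proof.
rewrite /dot (bigD1 i) //= mxE !eqxx mul1r big1 ?addr0 // => j ji.
by rewrite mxE eqxx (negbTE ji) mul0r.
Qed.
End Dot.

Definition annihilator (R : finComUnitRingType) d (w : 'rV[R]_d) : {set R} :=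
  [set s | s *: w == 0].

(** In a finite ring an element with the largest number of multiples divides
    everything it is comparable with.  Used both for the coordinates of a
    vector and for the set of nonunits. *)
Lemma chain_generator (R : finComUnitRingType) (P : pred R) :
  chain_ring R -> (exists a, P a) ->
  exists2 g, P g & forall b, P b -> ring_divides g b.
Proof.
move=> chR [a0 Pa0].
pose mults (a : R) := [set r * a | r in R].
case: (arg_maxnP (fun a => #|mults a|) Pa0) => g Pg gmax.
exists g => // b Pb; case: (chR g b) => [//|[r gE]].
have sub : mults g \subset mults b.
  by apply/subsetP=> _ /imsetP[s _ ->]; apply/imsetP; exists (s * r); rewrite // gE mulrA.
have := gmax b Pb; rewrite /= => le.
have /eqP E : mults g == mults b by rewrite eqEcard sub.
have : b \in mults g by rewrite E; apply/imsetP; exists 1; rewrite ?mul1r.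
by case/imsetP=> s _ ->; exists s.
Qed.

Definition primitive (R : finComUnitRingType) d (y : 'rV[R]_d) : bool :=
  [exists i, y 0 i \is a GRing.unit].

(** * Counting solutions of linear systems *)

(** Moving x along a unit coordinate of y brings it onto the hyperplane, and
    x is recovered from its image and from x.y. *)
Lemma card_affine_hyperplane (R : finComUnitRingType) d (t : R) (y : 'rV[R]_d) :
  primitive y -> (#|R| ^ d <= #|R| * #|[set x | dot x y == t]|)%N.
Proof.
case/existsP=> i yi.
pose H := [set x : 'rV[R]_d | dot x y == t].
pose f (x : 'rV[R]_d) := (dot x y, x + ((t - dot x y) / y 0 i) *: delta_mx 0 i).
have finj : injective f.
  by move=> x x' [E] /=; rewrite E => /addIr.
have fH x : f x \in finset.setX [set: R] H.
  by rewrite !inE dotDl dotZl dot_delta divrK //= addrC subrK.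
have <- : #|'rV[R]_d| = (#|R| ^ d)%N by rewrite card_mx mul1n.
rewrite -cardsT -(cardsT R) -cardsX -(card_imset _ finj).
by apply: subset_leq_card; apply/subsetP=> _ /imsetP[x _ ->]; apply: fH.
Qed.

(** Let c generate the ideal of the coordinates of w.  From one solution x0 one
    builds f with f.y = 0 and f.w = c; then the solutions, translated by
    a x0 + r f, fill R^d with multiplicity at most |Ann c| = |Ann w|. *)
Lemma card_affine_section (R : finComUnitRingType) d (t : R) (y w : 'rV[R]_d) :
  chain_ring R -> t \is a GRing.unit ->
  (#|[set x | (dot x y == t) && (dot x w == 0%R)]| * (#|R| * #|R|)
     <= #|R| ^ d * #|annihilator w|)%N.
Proof.
move=> chR tU; set S := [set x | _].
have [-> | /set0Pn[x0]] := eqVneq S set0; first by rewrite cards0.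
rewrite inE => /andP[/eqP x0y /eqP x0w].
have [i0 _ | no_coord] := pickP 'I_d; last first.
  by move: tU; rewrite -x0y /dot big1 ?unitr0 // => i; have := no_coord i.
have [|c /existsP[i /eqP wi] cdiv] := chain_generator (P := fun c => [exists i, w 0 i == c]) chR.
  by exists (w 0 i0); apply/existsP; exists i0.
have annE s : s * c = 0 -> s \in annihilator w.
  move=> sc; rewrite inE; apply/eqP/rowP=> j; rewrite !mxE.
  have [|r ->] := cdiv (w 0 j); first by apply/existsP; exists j.
  by rewrite mulrCA sc mulr0.
pose f : 'rV[R]_d := delta_mx 0 i - (y 0 i / t) *: x0.
have fy : dot f y = 0 by rewrite dotDl dotNl dotZl dot_delta x0y divrK // subrr.
have fw : dot f w = c by rewrite dotDl dotNl dotZl dot_delta x0w mulr0 subr0.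
(* r is determined by r * c together with its offset r - rho (r * c) from a
   chosen quotient rho (r * c), and that offset annihilates c; this is what
   makes g below injective. *)
pose rho b : R := odflt 0 [pick r : R | r * c == b].
have rhoK r : rho (r * c) * c = r * c.
  by rewrite /rho; case: pickP => [r' /eqP //|/(_ r)]; rewrite eqxx.
pose g (u : 'rV[R]_d * (R * R)) := (u.1 + u.2.1 *: x0 + u.2.2 *: f, u.2.2 - rho (u.2.2 * c)).
have <- : #|'rV[R]_d| = (#|R| ^ d)%N by rewrite card_mx mul1n.
rewrite -(cardsT R) -(cardsT 'rV[R]_d) -!cardsX.
rewrite -(card_in_imset (f := g)).
  apply: subset_leq_card; apply/subsetP=> _ /imsetP[u _ ->].
  rewrite !inE /=; apply/eqP/rowP=> j.
  have /annE : (u.2.2 - rho (u.2.2 * c)) * c = 0 by rewrite mulrBl rhoK subrr.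
  by rewrite inE => /eqP/rowP/(_ j).
move=> [x [a r]] [x' [a' r']]; rewrite !inE !andbT /=.
move=> /andP[/eqP xy /eqP xw] /andP[/eqP x'y /eqP x'w] [E1 E2].
have ea : a = a'.
  have := congr1 (fun v => dot v y) E1; rewrite /= !dotDl !dotZl fy !mulr0 !addr0 xy x'y x0y.
  by move=> /addrI /(mulIr tU).
have erc : r * c = r' * c.
  have := congr1 (fun v => dot v w) E1; rewrite /= !dotDl !dotZl fw xw x'w x0w.
  by rewrite !mulr0 !add0r.
have er : r = r' by move: E2; rewrite erc => /addIr.
by move: E1; rewrite ea er => /addIr/addIr ->.
Qed.

(** A generator of the maximal ideal is a zero divisor, and whatever kills it
    kills all nonunits. *)
Lemma chain_ring_socle (R : finComUnitRingType) : chain_ring R ->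
  exists2 s : R, s != 0 & forall x, x \isn't a GRing.unit -> s * x = 0.
Proof.
move=> chR.
have [|g gN gdiv] := chain_generator (P := fun x : R => x \isn't a GRing.unit) chR.
  by exists 0; rewrite unitr0.
have [s s0 sg] : exists2 s : R, s != 0 & s * g = 0.
  case: (pickP [pred s : R | (s != 0) && (s * g == 0)]) => [s /andP[s0 /eqP sg]|none].
    by exists s.
  case/negP: gN; have ginj : injective (fun r : R => r * g).
    move=> r r' /eqP; rewrite -subr_eq0 -mulrBl => rg; apply/eqP.
    by rewrite -subr_eq0; have := none (r - r'); rewrite /= rg andbT => /negbFE.
  have [h _ hK] := injF_bij ginj.
  by apply/unitrPr; exists (h 1); rewrite mulrC hK.
exists s => // x /gdiv[r ->]; by rewrite mulrCA sg mulr0.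
Qed.

(** * The second moment argument *)

Lemma sum_sqr_leq (T : finType) (S : {set T}) (f : T -> nat) :
  ((\sum_(x in S) f x) ^ 2 <= #|S| * \sum_(x in S) f x ^ 2)%N.
Proof.
rewrite -(leq_pmul2l (isT : 0 < 2)%N) -mulnn.
have -> : (2 * (#|S| * \sum_(x in S) f x ^ 2) =
  \sum_(x in S) \sum_(y in S) (f x ^ 2 + f y ^ 2))%N.
  under [RHS]eq_bigr do rewrite big_split sum_nat_const /=.
  by rewrite big_split /= sum_nat_const -big_distrr /= mul2n addnn.
rewrite big_distrlr /= big_distrr; apply: leq_sum => x _ /=.
rewrite big_distrr; apply: leq_sum => y _ /=.
by rewrite nat_Cauchy.
Qed.

(** Both error terms of the argument, the number of nonprimitive vectors and
    the excess of the second moment, are bounded by this one quantity. *)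
Definition annihilator_weight (R : finComUnitRingType) (d : nat) : nat :=
  \sum_(s : R | s != 0%R) #|[set w : 'rV[R]_d | s *: w == 0%R]|.

Lemma card_nonprimitive (R : finComUnitRingType) d : chain_ring R ->
  (#|[set y : 'rV[R]_d | ~~ primitive y]| <= annihilator_weight R d)%N.
Proof.
move=> /chain_ring_socle[s s0 sN].
rewrite /annihilator_weight (bigD1 s) //=.
apply: leq_trans (leq_addr _ _); apply: subset_leq_card; apply/subsetP=> y.
rewrite !inE negb_exists => /forallP yN; apply/eqP/rowP=> i.
by rewrite !mxE sN.
Qed.

(** Summing over the killing scalars instead: s = 0 contributes |E|, and a
    nonzero s contributes at most all the vectors that it kills. *)
Lemma sum_annihilator_diff (R : finComUnitRingType) d (E : {set 'rV[R]_d}) y :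
  (\sum_(z in E) #|annihilator (z - y)| <= #|E| + annihilator_weight R d)%N.
Proof.
rewrite /annihilator.
under eq_bigr do rewrite -sum1_card big_mkcond /=.
rewrite exchange_big /= (bigD1 0) //=; apply: leq_add.
  by rewrite -sum1_card; apply: leq_sum => z _; case: ifP.
apply: leq_sum => s _.
rewrite -big_mkcondr /= sum1dep_card.
rewrite -(card_imset _ (addIr (- y))); apply: subset_leq_card.
apply/subsetP=> _ /imsetP[z + ->]; by rewrite !inE => /andP[].
Qed.

Definition incidences (R : finComUnitRingType) d (E : {set 'rV[R]_d}) t x :=
  #|[set y in E | dot x y == t]|.

Lemma incidencesE (R : finComUnitRingType) d (E : {set 'rV[R]_d}) t x :
  incidences E t x = (\sum_(y in E) (dot x y == t))%N.
Proof. by rewrite /incidences -sum1dep_card big_mkcondr /=; apply: eq_bigr => y _; case: eqP. Qed.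

Lemma incidence_first_moment (R : finComUnitRingType) d (E : {set 'rV[R]_d}) t :
  {in E, forall y, primitive y} ->
  (#|E| * #|R| ^ d <= #|R| * \sum_x incidences E t x)%N.
Proof.
move=> Eprim; under eq_bigr do rewrite incidencesE.
rewrite exchange_big /= -sum_nat_const big_distrr /=.
apply: leq_sum => y yE.
apply: leq_trans (card_affine_hyperplane t (Eprim y yE)) _.
rewrite leq_mul2l -sum1dep_card big_mkcond /=.
by apply/orP; right; apply: leq_sum => x _; case: eqP.
Qed.

(** The pair x.y = x.z = t is rewritten as x.y = t, x.(z - y) = 0. *)
Lemma incidence_second_moment (R : finComUnitRingType) d (E : {set 'rV[R]_d}) t :
  chain_ring R -> t \is a GRing.unit ->
  (#|R| ^ 2 * \sum_x incidences E t x ^ 2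
     <= #|R| ^ d * (#|E| * (#|E| + annihilator_weight R d)))%N.
Proof.
move=> chR tU.
have -> : (\sum_x incidences E t x ^ 2 = \sum_(y in E) \sum_(z in E)
    #|[set x | (dot x y == t) && (dot x (z - y) == 0%R)]|)%N.
  under eq_bigr do rewrite incidencesE -mulnn big_distrlr /=.
  rewrite exchange_big /=; apply: eq_bigr => y _.
  rewrite exchange_big /=; apply: eq_bigr => z _.
  rewrite -sum1dep_card [RHS]big_mkcond /=; apply: eq_bigr => x _.
  rewrite dotBr subr_eq0.
  by case: eqP => [->|_] /=; [rewrite mul1n; case: eqP | rewrite mul0n].
rewrite -[in leqRHS]sum_nat_const !big_distrr /=; apply: leq_sum => y _.
apply: (@leq_trans (\sum_(z in E) #|R| ^ d * #|annihilator (z - y)|)); last first.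
  by rewrite -big_distrr leq_mul2l sum_annihilator_diff orbT.
rewrite big_distrr; apply: leq_sum => z _ /=.
by rewrite mulnC -mulnn card_affine_section.
Qed.

(** The support of N avoids both the primitive vectors of E, by hypothesis, and
    the nonprimitive vectors, whose dot products are never units; comparing
    the two moments on this smaller support gives the bound. *)
Theorem dot_product_free_bound (R : finComUnitRingType) d (E : {set 'rV[R]_d}) t :
  chain_ring R -> t \is a GRing.unit ->
  {in E &, forall x y, dot x y != t} ->
  (#|E| ^ 2 <= #|R| ^ d * annihilator_weight R d)%N.
Proof.
move=> chR tU Et; set W := annihilator_weight R d.
pose N := [set y : 'rV[R]_d | ~~ primitive y].
pose E' := [set y in E | primitive y].
pose S := [set x | incidences E' t x != 0]%N.
have cardE : (#|E| <= #|E'| + #|N|)%N.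
  apply: leq_trans (leq_card_setU _ _); apply: subset_leq_card.
  by apply/subsetP=> y yE; rewrite !inE yE /= orbN.
have NW : (#|N| <= W)%N by apply: card_nonprimitive.
have cardS : (#|S| + (#|E'| + #|N|) <= #|R| ^ d)%N.
  have <- : #|'rV[R]_d| = (#|R| ^ d)%N by rewrite card_mx mul1n.
  have d1 : [disjoint E' & N].
    by apply/pred0P => y; rewrite /= !inE; case: primitive; rewrite ?andbF.
  have d2 : [disjoint S & E' :|: N].
    apply/pred0P => x /=; apply/negP; rewrite inE => /andP[/negP xS xEN].
    case: xS; rewrite /incidences cards_eq0; apply/eqP/setP => y; rewrite !inE.
    apply/negP => /andP[/andP[yE yP] /eqP xy].
    move: xEN; rewrite !inE => /orP[/andP[xE _]|xN].
      by have := Et _ _ xE yE; rewrite xy eqxx.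
    (* A nonzero scalar kills x, hence would kill the unit t. *)
    have [s s0 sN] := chain_ring_socle chR.
    case/negP: s0; rewrite -(mulIr_eq0 _ (mulIr tU)) -xy.
    rewrite -dotZl (_ : s *: x = 0).
      by rewrite /dot big1 // => i _; rewrite mxE mul0r.
    apply/rowP=> i; rewrite !mxE sN //.
    by move: xN; rewrite negb_exists => /forallP.
  have /eqP <- : #|E' :|: N| == (#|E'| + #|N|)%N by rewrite leq_card_setU.
  have /eqP <- : #|S :|: (E' :|: N)| == (#|S| + #|E' :|: N|)%N.
    by rewrite leq_card_setU.
  exact: max_card.
have R0 : (0 < #|R|)%N by apply/card_gt0P; exists 0.
have Q0 : (0 < #|R| ^ d)%N by rewrite expn_gt0 R0.
have m1 : (#|E'| * #|R| ^ d <= #|R| * \sum_x incidences E' t x)%N.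
  by apply: incidence_first_moment => y; rewrite inE => /andP[].
have m2 := incidence_second_moment E' chR tU.
have CS := sum_sqr_leq S (incidences E' t).
have supp k : (0 < k)%N ->
    (\sum_x incidences E' t x ^ k = \sum_(x in S) incidences E' t x ^ k)%N.
  move=> k0; rewrite [RHS]big_mkcond /=; apply: eq_bigr => x _; rewrite inE.
  by case: eqP => //= ->; rewrite exp0n.
have supp1 : (\sum_x incidences E' t x = \sum_(x in S) incidences E' t x)%N.
  exact: (supp 1%N).
move: m1 m2 CS; rewrite supp // supp1.
move: cardE NW cardS R0 Q0; rewrite -/W.
move: #|E| #|E'| #|N| #|S| W #|R| (#|R| ^ d)%N (\sum_(x in S) _)%N
  (\sum_(x in S) _ ^ 2)%N.
clear => a e T S W q Q n m aeT TW SQ q0 Q0 m1 m2 CS.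
have [e0|e0] := posnP e; first by nia.
have key : (e * Q <= S * (e + W))%N.
  (* Square the first moment bound before comparing with the second. *)
  rewrite -(leq_pmul2l (m := e * Q)%N) ?muln_gt0 ?e0 //.
  apply: (@leq_trans ((q * n) ^ 2)); first by rewrite mulnn leq_exp2r.
  rewrite expnMn; apply: (@leq_trans (S * (q ^ 2 * m))).
    by rewrite mulnCA leq_mul2l CS orbT.
  apply: (@leq_trans (S * (Q * (e * (e + W))))); first by rewrite leq_mul2l m2 orbT.
  by apply: eq_leq; nia.
apply: (@leq_trans ((e + T) * (e + W))); first by nia.
have : ((S + (e + T)) * (e + W) <= Q * (e + W))%N by rewrite leq_mul2r SQ orbT.
nia.
Qed.

(** * The ring of integers modulo a prime power *)

Lemma card_row_in (T : finType) d (B : {set T}) :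
  #|[set w : 'rV[T]_d | [forall i, w 0 i \in B]]| = (#|B| ^ d)%N.
Proof.
rewrite -[d in RHS]card_ord -card_ffun_on.
have rinj : injective (fun f : {ffun 'I_d -> T} => \row_i f i).
  by move=> f g /rowP E; apply/ffunP => i; have := E i; rewrite !mxE.
rewrite -(card_imset _ rinj); apply: eq_card => w; rewrite inE.
apply/forallP/imsetP => [wB|[f /ffun_onP fB -> i]]; last by rewrite mxE fB.
exists [ffun i => w 0 i]; first by apply/ffun_onP => i; rewrite ffunE.
by apply/rowP => i; rewrite mxE ffunE.
Qed.

(** Among p consecutive integers starting at a multiple of p, all but the
    first are prime to p. *)
Lemma sum_gcdn_exp_prime_powerS (p l d : nat) : prime p ->
  (\sum_(0 <= s < p ^ l.+1) gcdn s (p ^ l.+1) ^ d =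
   p ^ l * (p - 1) + p ^ d * \sum_(0 <= s < p ^ l) gcdn s (p ^ l) ^ d)%N.
Proof.
move=> p_pr; rewrite [in X in (\sum_(_ <= _ < X) _)%N]expnSr big_nat_mul.
rewrite big_distrr /= -[X in _ = (X * _ + _)%N]subn0.
rewrite -sum_nat_const_nat -big_split /=; apply: eq_bigr => s _.
rewrite big_ltn ?ltn_mul2r ?prime_gt0 //= addnC; congr addn; last first.
  by rewrite expnSr -muln_gcdl expnMn mulnC.
rewrite mulSn big_nat (eq_bigr (fun=> 1%N)); last first.
  move=> j jb; suff /eqP -> : coprime j (p ^ l.+1) by rewrite exp1n.
  rewrite coprime_sym coprimeXl // prime_coprime //.
  apply/negP => /dvdnP[k jE]; move: jb; rewrite jE.
  by rewrite -mulSn !ltn_mul2r !ltnS => /andP[/andP[_ h1] /andP[_ h2]]; lia.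
by rewrite -big_nat sum_nat_const_nat muln1; lia.
Qed.

(** With q = p^(l+1), subtracting the term q^d of s = 0 leaves at most
    q^d / p^(d-1) - p^l.  The correction p^l is what makes the induction
    close, and the induction step is where d >= 2 enters. *)
Lemma sum_gcdn_exp_prime_power (p l d : nat) : prime p -> (1 < d)%N ->
  (p ^ d.-1 * (\sum_(0 <= s < p ^ l.+1) gcdn s (p ^ l.+1) ^ d) + p ^ d.-1 * p ^ l
     <= p ^ d.-1 * (p ^ l.+1) ^ d + (p ^ l.+1) ^ d)%N.
Proof.
move=> p_pr d1; have p0 := prime_gt0 p_pr.
have pP : (p <= p ^ d.-1)%N by rewrite -{1}(expn1 p) leq_exp2l ?prime_gt1 //; lia.
have pd : (p ^ d = p * p ^ d.-1)%N by rewrite -expnS; congr expn; lia.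
elim: l => [|l IH]; rewrite sum_gcdn_exp_prime_powerS //.
  rewrite expn0 big_nat1 gcd0n exp1n expn1 pd.
  by apply: eq_leq; move: (p ^ d.-1)%N => P; nia.
rewrite (expnS p l.+1) (expnMn p) pd.
move: IH pP; rewrite (expnS p l).
move: (p ^ l)%N (p ^ d.-1)%N ((p * p ^ l) ^ d)%N (\sum_(0 <= s < p * p ^ l) gcdn s (p * p ^ l) ^ d)%N.
clear -p0 => x P y G IH pP.
have : (p * P * (P * G + P * x) <= p * P * (P * y + y))%N by rewrite leq_mul2l IH orbT.
have : (p * P * x * p <= p * P * x * P)%N by rewrite leq_mul2l pP orbT.
have : (p * x * (p - 1) + p * x = p * x * p)%N by nia.
move: (p * x * (p - 1))%N => z; nia.
Qed.

Section PrimePower.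
Variables (p l : nat).
Hypotheses (p_pr : prime p) (l_gt0 : (0 < l)%N).
Let q := (p ^ l)%N.

Let q_gt1 : (1 < q)%N.
Proof. by rewrite -(exp1n l) ltn_exp2r // prime_gt1. Qed.

Lemma natr_Zp_eq0 (n : nat) : ((n%:R : 'Z_q) == 0) = (q %| n)%N.
Proof. by rewrite -val_eqE /= val_Zp_nat. Qed.

(** By Bezout, a is associated with gcd(q, a), and the divisors of p^l are
    totally ordered by divisibility. *)
Lemma chain_Zp : chain_ring 'Z_q.
Proof.
have gcd_div (a b : 'Z_q) : (gcdn q a %| gcdn q b)%N -> ring_divides a b.
  move=> gab; have [u _ /dvdnP[v uE]] := Bezoutl a (ltnW q_gt1).
  have [k bE] := dvdnP (dvdn_trans gab (dvdn_gcdr q b)).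
  exists (- (k%:R * u%:R)); rewrite -(natr_Zp b) bE natrM.
  have : ((gcdn q a + u * a)%N%:R : 'Z_q) = 0.
    by apply/eqP; rewrite natr_Zp_eq0 uE dvdn_mull.
  rewrite natrD natrM natr_Zp => /eqP; rewrite addr_eq0 => /eqP ->.
  by rewrite mulrN mulNr mulrA.
move=> a b.
have [i _ aE] : exists2 i, (i <= l)%N & gcdn q a = (p ^ i)%N.
  by apply/(dvdn_pfactor _ _ p_pr); apply: dvdn_gcdl.
have [j _ bE] : exists2 j, (j <= l)%N & gcdn q b = (p ^ j)%N.
  by apply/(dvdn_pfactor _ _ p_pr); apply: dvdn_gcdl.
by case: (leqP i j) => [|/ltnW] ij; [left|right]; apply: gcd_div;
  rewrite aE bE dvdn_exp2l.
Qed.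

(** The elements killed by s are the multiples of q / gcd(s, q). *)
Lemma card_ann_Zp (s : 'Z_q) : (#|[set x : 'Z_q | (s * x == 0)%R]| <= gcdn s q)%N.
Proof.
set g := gcdn s q.
have q0 := ltnW q_gt1.
have g0 : (0 < g)%N by rewrite gcdn_gt0 q0 orbT.
have gq : (g %| q)%N by apply: dvdn_gcdr.
pose f (x : 'Z_q) : 'I_g.-1.+1 := inord (x %/ (q %/ g)).
have <- : #|'I_g.-1.+1| = g by rewrite card_ord prednK.
have ltq (x : 'Z_q) : (x < q)%N by rewrite -[ltnRHS](Zp_cast q_gt1).
have div (x : 'Z_q) : s * x = 0 -> (q %/ g %| x)%N.
  move=> sx; have : (q %| s * x)%N.
    by rewrite -natr_Zp_eq0 natrM !natr_Zp sx.
  rewrite -{1}(divnK gq) -{1}(divnK (dvdn_gcdl s q)) -/g mulnAC dvdn_pmul2r //.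
  rewrite Gauss_dvdr //.
  rewrite /coprime -(eqn_pmul2r g0) mul1n muln_gcdl !divnK //.
    by rewrite gcdnC.
  exact: dvdn_gcdl.
apply: (leq_card_in f) => x y; rewrite !inE => /eqP/div xd /eqP/div yd.
move=> /(congr1 val); rewrite /= !inordK; last first.
- by rewrite prednK // ltn_divLR ?divn_gt0 ?(dvdn_leq q0 gq) // mulnC divnK.
- by rewrite prednK // ltn_divLR ?divn_gt0 ?(dvdn_leq q0 gq) // mulnC divnK.
by move=> E; apply: val_inj; rewrite /= -(divnK xd) E divnK.
Qed.

Lemma annihilator_weight_Zp d : (1 < d)%N ->
  (p ^ d.-1 * annihilator_weight 'Z_q d <= q ^ d)%N.
Proof.
move=> d1; have q0 := ltnW q_gt1.
have le : (annihilator_weight 'Z_q d + q ^ d <= \sum_(0 <= s < q) gcdn s q ^ d)%N.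
  have -> : (\sum_(0 <= s < q) gcdn s q ^ d = \sum_(s : 'Z_q) gcdn s q ^ d)%N.
    by rewrite -(big_mkord xpredT (fun s => gcdn s q ^ d)%N) Zp_cast.
  rewrite (bigD1 0) //= gcd0n addnC leq_add2l.
  apply: leq_sum => s _; apply: (@leq_trans (#|[set x : 'Z_q | s * x == 0%R]| ^ d)).
    rewrite -card_row_in; apply: subset_leq_card; apply/subsetP => w.
    rewrite !inE => /eqP/rowP sw; apply/forallP => i; rewrite inE.
    by have := sw i; rewrite !mxE => /eqP.
  by rewrite leq_exp2r ?card_ann_Zp //; lia.
have := sum_gcdn_exp_prime_power l.-1 p_pr d1.
rewrite prednK // -/q => h.
have : (p ^ d.-1 * (annihilator_weight 'Z_q d + q ^ d) <= p ^ d.-1 * \sum_(0 <= s < q) gcdn s q ^ d)%N.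
  by rewrite leq_mul2l le orbT.
move: h; rewrite mulnDr.
lia.
Qed.

(** For d = 1 the bound only says that A has at most q elements. *)
Lemma dot_free_Zp d (A : {set 'Z_q}) (t : 'Z_q) : (0 < d)%N ->
  t \is a GRing.unit -> t \notin dfold_sumset d (prodset A A) ->
  (#|A| ^ (2 * d) * p ^ d.-1 <= q ^ (2 * d))%N.
Proof.
move=> d0 tU tA; have cardZ : #|'Z_q| = q by rewrite card_ord Zp_cast.
have [d1|d1] := leqP d 1.
  have -> : d = 1%N by lia.
  by rewrite expn0 muln1 leq_exp2r // -[leqRHS]cardZ max_card.
pose E := [set w : 'rV['Z_q]_d | [forall i, w 0 i \in A]].
have bound : (#|E| ^ 2 <= #|'Z_q| ^ d * annihilator_weight 'Z_q d)%N.
  apply: (dot_product_free_bound chain_Zp tU) => x y.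
  rewrite !inE => /forallP xA /forallP yA; apply: contra tA => /eqP <-.
  apply/imsetP; exists [ffun i => x 0 i * y 0 i].
    by apply/ffun_onP => i; rewrite ffunE; apply: imset2_f.
  by apply: eq_bigr => i _; rewrite ffunE.
rewrite card_row_in cardZ -expnM in bound.
rewrite mulnC (mulnC 2%N).
apply: leq_trans (leq_mul (leqnn _) bound) _.
by rewrite mulnCA muln2 -addnn expnD leq_mul2l annihilator_weight_Zp // orbT.
Qed.
End PrimePower.

(** * From the counting bound to the real exponent *)

(** As q^(1/l) = p, the threshold is q p^(-(d-1)/(2d)). *)
Lemma powR_threshold (R : realType) (p l d : nat) : (0 < p)%N -> (0 < l)%N -> (0 < d)%N ->
  (((p ^ l)%N%:R : R) `^ ((2 * l%:R - 1) / (2 * l%:R) + 1 / (2 * l%:R * d%:R))) ^+ (2 * d)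
   * p%:R ^+ d.-1 = (p ^ l)%N%:R ^+ (2 * d).
Proof.
move=> p0 l0 d0.
have l0' : l%:R != 0 :> R by rewrite pnatr_eq0 -lt0n.
have d0' : d%:R != 0 :> R by rewrite pnatr_eq0 -lt0n.
have p0' : p%:R != 0 :> R by rewrite pnatr_eq0 -lt0n.
rewrite -(powR_mulrn _ (powR_ge0 _ _)) natrX -exprM.
rewrite -!(powR_mulrn _ (ler0n _ _)) -!powRrM -powRD; last by rewrite p0' implybT.
congr (_ `^ _); rewrite !natrM -subn1 natrB //.
by field; rewrite l0' d0'.
Qed.

Theorem corollary1p3p3 (R : realType) (p l d : nat)
  (p_prime : prime p) (p_odd : odd p) (l_gt0 : (0 < l)%N) (d_gt0 : (0 < d)%N)
  (A : {set 'Z_(p ^ l)})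
  (A_large : ((p ^ l)%N%:R : R) `^ ((2 * l%:R - 1) / (2 * l%:R)
                                    + 1 / (2 * l%:R * d%:R)) < #|A|%:R) :
  unit_set 'Z_(p ^ l) \subset dfold_sumset d (prodset A A).
Proof.
apply/subsetP => t; rewrite inE => tU; apply: contraT => tA.
have := dot_free_Zp p_prime l_gt0 d_gt0 tU tA.
rewrite -(ler_nat R) natrM (natrX _ #|A|) (natrX _ p d.-1) (natrX _ (p ^ l)%N).
rewrite -(powR_threshold R (prime_gt0 p_prime) l_gt0 d_gt0).
rewrite ler_pM2r ?exprn_gt0 ?ltr0n ?prime_gt0 //.
rewrite ler_pXn2r ?nnegrE ?powR_ge0 ?ler0n ?muln_gt0 //.
by rewrite leNgt A_large.
Qed.
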